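(* Let $X_n$ be a time-homogeneous Markov chain on $\mathbb{R}$ such that $\limsup_{n\to\infty}X_n=\infty$ almost surely, and let $B\subseteq\mathbb{R}$ be a Borel set. Assume that, for some positive function $g(x)$ and for all $y\in\mathbb{R}$, $$H_y(x+B)\sim g(x)\qquad\text{as }x\to\infty,$$ and that, for some $c<\infty$, $$H_y(x+B)\le c\,g(x)\qquad\text{for all }x,y\in\mathbb{R}.$$ If $z$ is a finite non-negative measure on $\mathbb{R}$ and $Z(A):=\int_{\mathbb{R}}z(du)\,H_u(A)$ for Borel $A\subseteq\mathbb{R}$, then $$Z(x+B)\sim z(\mathbb{R})\,g(x)\qquad\text{as }x\to\infty.$$
   Context: For a time-homogeneous Markov chain $X_n$ on $\mathbb{R}$ with transition kernel $P(x,\cdot)$, the renewal measure started at $y$ is $H_y(A):=\sum_{n=0}^\infty\mathbb{P}\{X_n\in A\mid X_0=y\}$, $A\subseteq\mathbb{R}$ Borel. The measure $Z$ is the solution $Z(A)=\int_{\mathbb{R}}z(du)H_u(A)$ of the renewal equation $Z(A)=z(A)+\int_{\mathbb{R}}Z(dy)P(y,A)$. Here $x+B=\{x+b:b\in B\}$ and $f\sim g$ means $f/g\to1$. *)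

(* Defs.v *)
(* MathComp-Analysis; the real line is an arbitrary [R : realType]. *)
From mathcomp Require Import all_boot all_order all_algebra.
From mathcomp Require Import all_classical all_reals all_analysis.

Set Implicit Arguments.
Unset Strict Implicit.
Unset Printing Implicit Defensive.

Import Order.TTheory GRing.Theory Num.Theory.
Import numFieldNormedType.Exports.

Local Open Scope classical_set_scope.
Local Open Scope ring_scope.
Local Open Scope ereal_scope.

Definition translate (R : realType) (x : R) (B : set R) : set R :=
  [set (x + b)%R | b in B].

Definition history (d : measure_display) (Omega : measurableType d)
    (R : realType) (X : nat -> {mfun Omega >-> R}) (n : nat) :
    set (set Omega) :=
  <<s [set E | exists2 k, (k <= n)%N & g_sigma_algebra_preimage (X k) E] >>.

(* The Markov property is P(X_{n+1} \in A | X_0, ..., X_n) = P(X_n, A) a.s.,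
   written out through the defining property of conditional expectation. *)
Definition markov_chain_from (d : measure_display) (Omega : measurableType d)
    (R : realType) (P : R.-pker R ~> R) (X : nat -> {mfun Omega >-> R})
    (Pr : probability Omega R) (y : R) : Prop :=
  {ae Pr, forall w, X 0%N w = y} /\
  forall (n : nat) (E : set Omega) (A : set R),
    history X n E -> measurable A ->
    Pr (E `&` X n.+1 @^-1` A) = \int[Pr]_(w in E) P (X n w) A.

(* As usual for a chain specified by its kernel only, there is one law [Pr y]
   on the underlying space for each starting point [y]; statements conditional
   on X_0 = y are statements about [Pr y]. *)
Definition markov_chain (d : measure_display) (Omega : measurableType d)
    (R : realType) (P : R.-pker R ~> R) (X : nat -> {mfun Omega >-> R})
    (Pr : R -> probability Omega R) : Prop :=
  forall y, markov_chain_from P X (Pr y) y.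

Definition renewal_measure (d : measure_display) (Omega : measurableType d)
    (R : realType) (X : nat -> {mfun Omega >-> R})
    (Pr : R -> probability Omega R) (y : R) (A : set R) : \bar R :=
  \sum_(0 <= n <oo) Pr y (X n @^-1` A).

Definition renewal_solution (d : measure_display) (Omega : measurableType d)
    (R : realType) (X : nat -> {mfun Omega >-> R})
    (Pr : R -> probability Omega R) (z : {finite_measure set R -> \bar R})
    (A : set R) : \bar R :=
  \int[z]_u renewal_measure X Pr u A.

(* f / h --> 1 at +oo. The quotient 0 / 0 is read as 1, so that the zero
   function is equivalent to itself; this only matters where h vanishes. *)
Definition asymp_equiv (R : realType) (f h : R -> \bar R) : Prop :=
  (if (f x == 0) && (h x == 0) then 1 else f x / h x) @[x --> +oo%R] --> 1.

(* Main.v *)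
(* The Markov property makes y |-> P_y(X_n \in A) measurable, so H_y(A) can be
   integrated in y. The ratios H_u(x + B) / g(x) tend to 1 for every u and are
   bounded by c, which is z-integrable; dominated convergence along every
   sequence x_n -> +oo gives Z(x_n + B) / g(x_n) -> z(R). *)
Require Import Defs.
From mathcomp Require Import all_boot all_order all_algebra.
From mathcomp Require Import all_classical all_reals all_analysis.
From mathcomp Require Import measurable_realfun.

Import Order.TTheory GRing.Theory Num.Theory.
Import numFieldNormedType.Exports.

Local Open Scope classical_set_scope.
Local Open Scope ring_scope.
Local Open Scope ereal_scope.

Lemma measurable_translate (R : realType) (x : R) (B : set R) :
  measurable B -> measurable (translate x B).
Proof.
move=> mB.
have -> : translate x B = (fun t => t - x)%R @^-1` B.
  apply/seteqP; split => [_ [b Bb <-] /=|t Bt]; first by rewrite addrC addKr.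
  by exists (t - x)%R => //; rewrite addrC subrK.
rewrite -[_ @^-1` _]setTI.
have: measurable_fun [set: R] (fun t => t - x)%R by exact: measurable_funD.
by apply.
Qed.

(** Induction on [n]. At time 0 the chain sits at [y] almost surely, so the function is the
    indicator of [A]; afterwards the Markov property writes the law of [X n.+1] as the law of [X n]
    integrated against [P]. *)
Lemma measurable_marginal (R : realType) (d : measure_display)
    (Omega : measurableType d) (P : R.-pker R ~> R)
    (X : nat -> {mfun Omega >-> R}) (Pr : R -> probability Omega R)
    (n : nat) (A : set R) :
  markov_chain P X Pr -> measurable A ->
  measurable_fun [set: R] (fun y => Pr y (X n @^-1` A)).
Proof.
(* [A] stays general: the induction step needs the law of [X n] to depend measurably on [y] on every
   measurable set. *)
move=> mc; elim: n A => [|n IHn] A mA.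
  have mX0 C : measurable C -> measurable (X 0%N @^-1` C).
    by move=> mC; rewrite -[_ @^-1` _]setTI; exact: measurable_funPT.
  (* Used with [C] equal to [A] when [y] is outside [A], and to its complement when [y] is in
     [A]. *)
  have outside0 y C : measurable C -> ~ C y -> Pr y (X 0%N @^-1` C) = 0.
    move=> mC nCy; apply: (measure_negligible (mX0 _ mC)).
    by apply: negligibleS (mc y).1 => w /= XC Xy; apply: nCy; rewrite -Xy.
  have -> : (fun y => Pr y (X 0%N @^-1` A)) = (fun y => (\1_A y)%:E).
    apply/funext => y; have [Ay|nAy] := pselect (A y).
      rewrite indicE mem_set//= -(setCK A) -preimage_setC.
      rewrite probability_setC; last exact/mX0/measurableC.
      by rewrite outside0 ?sube0//; exact: measurableC.
    by rewrite indicE memNset//= outside0.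
  exact/measurable_EFinP/measurable_indic.
have -> : (fun y => Pr y (X n.+1 @^-1` A)) =
          (fun y => \int[distribution (Pr y) (X n)]_x P x A).
  apply/funext => y; rewrite ge0_integral_pushforward//=; last first.
    exact: measurable_kernel.
  (* Markov property with the sure event as [E]; it remains to see that this event lies in
     [history X n]. *)
  rewrite preimage_setT -((mc y).2 n setT A)//; first by rewrite setTI.
  exact: (@measurableT _ (g_sigma_algebraType _)).
apply: (measurable_fun_integral_kernel
  (l := fun y => distribution (Pr y) (X n) : {measure set R -> \bar R})) => //.
exact: measurable_kernel.
Qed.

Lemma measurable_renewal_measure (R : realType) (d : measure_display)
    (Omega : measurableType d) (P : R.-pker R ~> R)
    (X : nat -> {mfun Omega >-> R}) (Pr : R -> probability Omega R)
    (A : set R) :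
  markov_chain P X Pr -> measurable A ->
  measurable_fun [set: R] (fun y => renewal_measure X Pr y A).
Proof.
move=> mc mA; apply: ge0_emeasurable_sum => // n _.
exact: measurable_marginal mc mA.
Qed.

Lemma renewal_measure_ge0 (R : realType) (d : measure_display)
    (Omega : measurableType d) (X : nat -> {mfun Omega >-> R})
    (Pr : R -> probability Omega R) (y : R) (A : set R) :
  0 <= renewal_measure X Pr y A.
Proof. exact: nneseries_ge0. Qed.

(** A nowhere vanishing [h] never triggers the 0/0 convention, and the extended inverse of [h x] is
    then the real one. *)
Lemma asymp_equivP (R : realType) (f : R -> \bar R) (h : R -> R) :
  (forall x, h x != 0)%R ->
  asymp_equiv f (fun x => (h x)%:E) <->
  f x * ((h x)^-1)%:E @[x --> +oo%R] --> 1.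
Proof.
move=> h0; rewrite /asymp_equiv.
suff -> : (fun x => if (f x == 0) && ((h x)%:E == 0) then 1 else
    f x / (h x)%:E) = (fun x => f x * ((h x)^-1)%:E) by [].
by apply/funext => x; rewrite eqe inver (negbTE (h0 x)) andbF.
Qed.

Theorem theorem9 (R : realType) (d : measure_display)
    (Omega : measurableType d) (P : R.-pker R ~> R)
    (X : nat -> {mfun Omega >-> R}) (Pr : R -> probability Omega R)
    (B : set R) (g : R -> R) (c : R) (z : {finite_measure set R -> \bar R}) :
  markov_chain P X Pr ->
  (forall y : R,
     {ae Pr y, forall w, limn_esup (fun n => (X n w)%:E) = +oo}) ->
  measurable B ->
  (forall x : R, (0 < g x)%R) ->
  (forall y : R,
     asymp_equiv (fun x => renewal_measure X Pr y (translate x B))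
                 (fun x => (g x)%:E)) ->
  (forall x y : R,
     renewal_measure X Pr y (translate x B) <= c%:E * (g x)%:E) ->
  asymp_equiv (fun x => renewal_solution X Pr z (translate x B))
              (fun x => z setT * (g x)%:E).
Proof.
move=> mc _ mB g_gt0 Hg Hc.
have g0 x : g x != 0%R by rewrite gt_eqF.
pose H x u := renewal_measure X Pr u (translate x B).
have mH x : measurable_fun [set: R] (H x).
  by apply: measurable_renewal_measure mc _; exact: measurable_translate.
have H_ge0 x u : 0 <= H x u by exact: renewal_measure_ge0.
have zfin : z setT \is a fin_num by exact: fin_num_measure.
(* For the null measure both sides vanish and the 0/0 convention makes the ratio 1. Otherwise one
   may divide by the total mass [r]. *)
have [z0|z_neq0] := eqVneq (z setT) 0.
  rewrite /asymp_equiv.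
  apply: cvg_near_cst; near=> x.
  rewrite z0 mul0e eqxx andbT ifT//; apply/eqP.
  apply: null_set_integral => //.
    exact: mH.
move: zfin z_neq0; case zE : (z setT) => [r| |]// _; rewrite eqe => r0.
rewrite (_ : (fun x => r%:E * (g x)%:E) = (fun x => (r * g x)%:E)) //.
apply/asymp_equivP => [x|]; first by rewrite mulf_neq0.
apply/cvge_pinftyP => x_ x_y.
pose F n u := H (x_ n) u * ((g (x_ n))^-1)%:E.
have mF n : measurable_fun [set: R] (F n).
  exact: emeasurable_funM.
have ginv_ge0 x : 0 <= ((g x)^-1)%:E :> \bar R by rewrite lee_fin invr_ge0 ltW.
have F1 u : F n u @[n --> \oo] --> 1.
  by move/asymp_equivP : (Hg u) => /(_ g0)/cvge_pinftyP; apply.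
(* The uniform bound on the renewal measures cancels [g]; the constant left is integrable because
   [z] is finite. *)
have Fc n u : `|F n u| <= c%:E.
  rewrite gee0_abs ?mule_ge0// /F.
  apply: le_trans (lee_wpmul2r (ginv_ge0 _) (Hc _ _)) _.
  by rewrite -!EFinM mulfK.
have [_ _] := dominated_convergence (mu := z) measurableT mF
  (measurable_cst (1 : \bar R)) (aeW _ (fun u _ => F1 u))
  (finite_measure_integrable_cst z c measurableT)
  (aeW _ (fun u n _ => Fc n u)).
(* The integrals of [F n] tend to that of 1, namely [r]; scaling by the inverse of [r] gives the
   limit 1. *)
rewrite integral_cst// mul1e [X in _ --> X](zE : _ = r%:E) => /(cvgeZr (y := (r^-1)%:E)) => /(_ isT).
rewrite -EFinM divff//; apply: cvg_trans; apply: near_eq_cvg; near=> n => /=.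
by rewrite ge0_integralZr// -muleA -EFinM -invfM [(_ * r)%R]mulrC.
Unshelve. all: by end_near. Qed.
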